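(* Let $g\in\mathcal M_K$ be given by $g=\beta Q|_{\mathfrak p}+\alpha_1Q|_{\mathfrak k_1}+\cdots+\alpha_{r+s}Q|_{\mathfrak k_{r+s}}$ with $\beta,\alpha_1,\dots,\alpha_{r+s}>0$. Then the Ricci curvature of $g$ satisfies $$\mathrm{Ric}(g)|_{\mathfrak p}=-\sum_{i=1}^{r+s}\Big(\frac{\alpha_i}{2\beta}+1\Big)\frac{d_i(1-\kappa_i)}{n}\,Q|_{\mathfrak p},\qquad \mathrm{Ric}(g)|_{\mathfrak k_j}=\frac14\Big(\frac{\alpha_j^2}{\beta^2}(1-\kappa_j)+\kappa_j\Big)Q|_{\mathfrak k_j},$$ and $\mathrm{Ric}(g)(\mathfrak p,\mathfrak k_j)=0$, $\mathrm{Ric}(g)(\mathfrak k_j,\mathfrak k_k)=0$ for all $j,k\in\{1,\dots,r+s\}$ with $j\ne k$.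
   Context: Let $G$ be a connected non-compact simple Lie group with Lie algebra $\mathfrak g$, $K$ a maximal compact subgroup with Lie algebra $\mathfrak k$, $B$ the Killing form of $\mathfrak g$, and $\mathfrak p$ the $B$-orthogonal complement of $\mathfrak k$ in $\mathfrak g$ (a Cartan decomposition $\mathfrak g=\mathfrak p\oplus\mathfrak k$). Let $Q=B|_{\mathfrak p}-B|_{\mathfrak k}$, an inner product on $\mathfrak g$. Write $\mathfrak k=\mathfrak k_1\oplus\cdots\oplus\mathfrak k_{r+s}$, where $\mathfrak k_1,\dots,\mathfrak k_r$ are the simple ideals of $[\mathfrak k,\mathfrak k]$, $\mathfrak k_{r+1}$ is the centre of $\mathfrak k$, and $s=1$ if the centre is nontrivial, $s=0$ otherwise. Let $n=\dim\mathfrak p$, $d_i=\dim\mathfrak k_i$, and define $\kappa_i$ by $B_i=\kappa_iB|_{\mathfrak k_i}$ where $B_i$ is the Killing form of $\mathfrak k_i$. Left-invariant $(0,2)$-tensor fields on $G$ are identified with bilinear forms on $\mathfrak g$; for a subspace $\mathfrak u\in\{\mathfrak p,\mathfrak k_1,\dots,\mathfrak k_{r+s}\}$, $Q|_{\mathfrak u}$ denotes the restriction of $Q$ to $\mathfrak u$, extended by zero on the $Q$-orthogonal complement when viewed as a form on $\mathfrak g$. $\mathcal M_K$ is the set of left-invariant metrics on $G$ that are naturally reductive with respect to $G\times K$ (acting on $G$ by $(x,k)y=xyk^{-1}$); by a theorem of Gordon these are exactly the metrics of the form $\beta Q|_{\mathfrak p}+\sum_i\alpha_iQ|_{\mathfrak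 k_i}$ with all coefficients positive. *)

(* Defs.v *)
(* real Lie algebras modelled on row vectors 'rV[R]_N,
   subspaces as row spaces of square matrices (mxalgebra, %MS scope). *)
From HB Require Import structures.
From mathcomp Require Import all_boot all_order all_algebra.
From mathcomp Require Import reals.
Set Implicit Arguments. Unset Strict Implicit. Unset Printing Implicit Defensive.
Import Order.TTheory GRing.Theory Num.Theory.
Local Open Scope ring_scope.

Section LieDefs.
Variables (R : realType) (N : nat).
Local Notation vec := 'rV[R]_N.
Implicit Types (br : vec -> vec -> vec) (U V W : 'M[R]_N).

Definition ebas (a : 'I_N) : vec := delta_mx 0 a.

Definition lie_algebra br :=
  [/\ forall (a : R) X Y Z, br (a *: X + Y) Z = a *: br X Z + br Y Z,
      forall X Y, br X Y = - br Y X &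
      forall X Y Z, br X (br Y Z) + br Y (br Z X) + br Z (br X Y) = 0].

Definition ideal_in br V U :=
  (U <= V)%MS /\ forall X Y, (X <= U)%MS -> (Y <= V)%MS -> (br X Y <= U)%MS.

Definition simple_subalg br U :=
  (exists X Y, [/\ (X <= U)%MS, (Y <= U)%MS & br X Y != 0]) /\
  forall V, ideal_in br U V -> \rank V = 0%N \/ (V :=: U)%MS.

Definition simple_lie br := simple_subalg br 1%:M.

(* adjoint endomorphism (acting on row vectors: v *m ad X = [X, v]) *)
Definition ad br (X : vec) : 'M[R]_N := lin1_mx (br X).

Definition killing br (X Y : vec) : R := \tr (ad br X *m ad br Y).

(* trace of the restriction to U of v |-> v *m A (A stabilising U) *)
Definition tr_on U (A : 'M[R]_N) : R :=
  \tr (row_base U *m A *m pinvmx (row_base U)).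

Definition killing_on br U (X Y : vec) : R := tr_on U (ad br X *m ad br Y).

Definition cartan_decomp br (k p : 'M[R]_N) :=
  [/\ mxdirect (k + p) /\ \rank (k + p)%MS = N,
      forall X Y, (X <= k)%MS -> (Y <= k)%MS -> (br X Y <= k)%MS,
      forall X Y, (X <= k)%MS -> (Y <= p)%MS -> (br X Y <= p)%MS,
      forall X Y, (X <= p)%MS -> (Y <= p)%MS -> (br X Y <= k)%MS &
      (forall X, (X <= k)%MS -> X != 0 -> killing br X X < 0) /\
      (forall X, (X <= p)%MS -> X != 0 -> 0 < killing br X X)].

Definition is_derived br (k D : 'M[R]_N) :=
  (forall X Y, (X <= k)%MS -> (Y <= k)%MS -> (br X Y <= D)%MS) /\
  forall W, (forall X Y, (X <= k)%MS -> (Y <= k)%MS -> (br X Y <= W)%MS) ->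
            (D <= W)%MS.

Definition is_center br (k Z : 'M[R]_N) :=
  forall X, (X <= Z)%MS <->
            ((X <= k)%MS /\ forall Y, (Y <= k)%MS -> br X Y = 0).

Definition Qform br (k p : 'M[R]_N) (X Y : vec) : R :=
  killing br (X *m proj_mx p k) (Y *m proj_mx p k)
  - killing br (X *m proj_mx k p) (Y *m proj_mx k p).

Definition gram (f : vec -> vec -> R) : 'M[R]_N :=
  \matrix_(a, b) f (ebas a) (ebas b).

Definition Qperp br k p U : 'M[R]_N :=
  kermx (gram (Qform br k p) *m (row_base U)^T).

(* Q|_U : restriction of Q to U, extended by zero on the Q-orthogonal
   complement of U *)
Definition Qrestr br k p U (X Y : vec) : R :=
  Qform br k p (X *m proj_mx U (Qperp br k p U))
               (Y *m proj_mx U (Qperp br k p U)).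

Definition ip (M : 'M[R]_N) (u v : vec) : R := (u *m M *m v^T) 0 0.

(* Levi-Civita connection on left-invariant vector fields (Koszul formula:
   2<nabla_X Y, Z> = <[X,Y],Z> - <[Y,Z],X> + <[Z,X],Y>) *)
Definition nabla br (M : 'M[R]_N) (X Y : vec) : vec :=
  (\row_c (2^-1 * (ip M (br X Y) (ebas c) - ip M (br Y (ebas c)) X
                   + ip M (br (ebas c) X) Y))) *m invmx M.

Definition curv br M (X Y Z : vec) : vec :=
  nabla br M X (nabla br M Y Z) - nabla br M Y (nabla br M X Z)
  - nabla br M (br X Y) Z.

Definition ricci br M (Y Z : vec) : R :=
  \sum_(c < N) (curv br M (ebas c) Y Z) 0 c.

End LieDefs.

(* Main.v *)
Require Import Defs.
From HB Require Import structures.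
From mathcomp Require Import all_boot all_order all_algebra.
From mathcomp Require Import reals complex ring lra.
Set Implicit Arguments.
Unset Strict Implicit.
Unset Printing Implicit Defensive.
Import Order.TTheory GRing.Theory Num.Theory.
Local Open Scope ring_scope.

(** Write [B] for the Killing form and [g = B(T -, -)], where [T] acts by [beta] on
    [p] and by [- alpha_i] on [k_i]. The Koszul formula gives
    [2 nabla_X Y = [X, Y] + ([X, YT] - [XT, Y]) T^-1], which is a multiple of
    [[X, Y]] on each pair of blocks. As [nabla] is torsion free and [X |-> nabla_X W]
    has trace zero, [Ric(Y, Z) = - tr (X |-> nabla_(nabla_X Y) Z)], and this trace
    is computed block by block. On [p] it reduces to the compressed Casimir forms
    of the [k_i]. These are [k]-invariant and symmetric, hence multiples of [B]
    because [p] is an irreducible [k]-module (an invariant subspace of [p]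
    generates a proper ideal of the simple algebra otherwise), and taking traces
    gives the factors [d_i (1 - kappa_i) / n]. *)

(** * Bilinear forms on row vectors given by matrices *)

Section BilinearForms.
Variables (R : realType) (N : nat).
Local Notation vec := 'rV[R]_N.
Implicit Types (u v w X Y Z : vec) (M A S P : 'M[R]_N).

Lemma eq_mx_mulrV n (A B : 'M[R]_(n, N)) :
  (forall u : 'rV_n, u *m A = u *m B) -> A = B.
Proof. by move=> eAB; apply/row_matrixP => i; rewrite !rowE eAB. Qed.

Lemma mul_rV_lin1_mx (f : vec -> vec) :
  linear f -> forall v, v *m lin1_mx f = f v.
Proof.
move=> flin v.
pose F : {linear vec -> vec} := HB.pack f (GRing.isLinear.Build _ _ _ _ f flin).
exact: (mul_rV_lin1 F v).
Qed.

Lemma ipDl M u v w : ip M (u + v) w = ip M u w + ip M v w.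
Proof. by rewrite /ip !mulmxDl mxE. Qed.

Lemma ipDr M u v w : ip M w (u + v) = ip M w u + ip M w v.
Proof. by rewrite /ip linearD mulmxDr mxE. Qed.

Lemma ipNl M u v : ip M (- u) v = - ip M u v.
Proof. by rewrite /ip !mulNmx mxE. Qed.

Lemma ipNr M u v : ip M u (- v) = - ip M u v.
Proof. by rewrite /ip linearN mulmxN mxE. Qed.

Lemma ipZl M a u v : ip M (a *: u) v = a * ip M u v.
Proof. by rewrite /ip -!scalemxAl mxE. Qed.

Lemma ipZr M a u v : ip M u (a *: v) = a * ip M u v.
Proof. by rewrite /ip linearZ -scalemxAr mxE. Qed.

Lemma ip0l M u : ip M 0 u = 0.
Proof. by rewrite /ip !mul0mx mxE. Qed.

Lemma ip0r M u : ip M u 0 = 0.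
Proof. by rewrite /ip trmx0 mulmx0 mxE. Qed.

Lemma ip_suml M I (r : seq I) (C : pred I) (F : I -> vec) v :
  ip M (\sum_(i <- r | C i) F i) v = \sum_(i <- r | C i) ip M (F i) v.
Proof.
by apply: (big_morph (fun u => ip M u v) (fun _ _ => ipDl _ _ _ _) (ip0l _ _)).
Qed.

Lemma ip_sumr M I (r : seq I) (C : pred I) (F : I -> vec) v :
  ip M v (\sum_(i <- r | C i) F i) = \sum_(i <- r | C i) ip M v (F i).
Proof.
by apply: (big_morph (fun u => ip M v u) (fun _ _ => ipDr _ _ _ _) (ip0r _ _)).
Qed.

Lemma ip_tr M u v : ip M u v = ip M^T v u.
Proof.
rewrite /ip -[u *m M *m v^T]trmxK mxE !trmx_mul trmxK mulmxA.
by [].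
Qed.

Lemma ip_ebasr M u a : ip M u (ebas R a) = (u *m M) 0 a.
Proof. by rewrite /ip /ebas trmx_delta -colE mxE. Qed.

Lemma ip_ebas M a b : ip M (ebas R a) (ebas R b) = M a b.
Proof. by rewrite ip_ebasr /ebas -rowE mxE. Qed.

Lemma gram_ip M : gram (ip M) = M.
Proof. by apply/matrixP => a b; rewrite mxE ip_ebas. Qed.

Lemma ip_gram (f : vec -> vec -> R) :
  (forall a u v w, f (a *: u + v) w = a * f u w + f v w) ->
  (forall a u v w, f w (a *: u + v) = a * f w u + f w v) ->
  forall u v, ip (gram f) u v = f u v.
Proof.
move=> fl fr u v.
have f0l w : f 0 w = 0.
  by have := fl (-1) 0 0 w; rewrite scaler0 addr0 mulN1r addNr.
have f0r w : f w 0 = 0.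
  by have := fr (-1) 0 0 w; rewrite scaler0 addr0 mulN1r addNr.
rewrite [u in LHS]row_sum_delta [v in LHS]row_sum_delta.
rewrite [u in RHS]row_sum_delta [v in RHS]row_sum_delta.
set U := (\sum_j v _ j *: _).
have eL w : f (\sum_(j < N) u 0 j *: 'e_j) w = \sum_(j < N) u 0 j * f 'e_j w.
  elim/big_rec2: _ => [|i x y _ IH]; first exact: f0l.
  by rewrite fl IH.
have eR w : f w U = \sum_(j < N) v 0 j * f w 'e_j.
  rewrite /U; elim/big_rec2: _ => [|i x y _ IH]; first exact: f0r.
  by rewrite fr IH.
rewrite eL ip_suml; apply: eq_bigr => i _; rewrite ipZl; congr (_ * _).
rewrite eR ip_sumr; apply: eq_bigr => j _; rewrite ipZr; congr (_ * _).
by rewrite ip_ebas mxE.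
Qed.

Lemma eq_ip M M' : (forall u v, ip M u v = ip M' u v) -> M = M'.
Proof.
move=> e; rewrite -[M]gram_ip -[M']gram_ip.
by apply/matrixP => a b; rewrite !mxE.
Qed.

Lemma ip_mull M A u v : ip M (u *m A) v = ip (A *m M) u v.
Proof. by rewrite /ip !mulmxA. Qed.

Lemma ip_mulr M A u v : ip M u (v *m A) = ip (M *m A^T) u v.
Proof. by rewrite /ip trmx_mul !mulmxA. Qed.

(** For the form [M], the adjoint of [A *m S] is [- (S *m A)]. Adjoint operators have equal trace,
    so by cyclicity this trace is its own negative. *)
Lemma tr_skew_selfadj M A S : M \in unitmx ->
  A *m M = - (M *m A^T) -> S *m M = M *m S^T -> \tr (A *m S) = 0.
Proof.
move=> Mu hA hS.
have e : \tr (A *m S) = - \tr (A *m S).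
  rewrite -{1}(mulmxK Mu S) hS !mulmxA hA !mulNmx linearN /= mxtrace_mulC.
  rewrite !mulmxA mulVmx // mul1mx -trmx_mul mxtrace_tr.
  by rewrite mxtrace_mulC.
by lra.
Qed.

End BilinearForms.

(** * Adjoint operators and invariance of the Killing form *)

Section LieAlgebra.
Variables (R : realType) (N : nat).
Local Notation vec := 'rV[R]_N.
Implicit Types (u v w X Y Z : vec) (M A S P T : 'M[R]_N).
Variable br : vec -> vec -> vec.
Hypothesis lie_br : lie_algebra br.
Local Notation B := (gram (killing br)).
Local Notation ad := (ad br).

Lemma br_linearl Z : linear (br^~ Z).
Proof. by case: lie_br => h _ _ a X Y; apply: h. Qed.

Lemma br_anti X Y : br X Y = - br Y X.
Proof. by case: lie_br. Qed.

Lemma br_linearr Z : linear (br Z).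
Proof.
by move=> a X Y; rewrite br_anti br_linearl opprD -scalerN -!(br_anti Z).
Qed.

Lemma mul_ad X v : v *m ad X = br X v.
Proof. by apply: mul_rV_lin1_mx; apply: br_linearr. Qed.

Lemma ad_is_linear : linear ad.
Proof.
move=> a X Y; apply: eq_mx_mulrV => v.
by rewrite mulmxDr -scalemxAr !mul_ad br_linearl.
Qed.

HB.instance Definition _ := GRing.isLinear.Build R vec 'M[R]_N _ ad ad_is_linear.

Lemma br_addl X Y Z : br (X + Y) Z = br X Z + br Y Z.
Proof. by rewrite -!mul_ad linearD mulmxDr. Qed.
Lemma br_addr X Y Z : br X (Y + Z) = br X Y + br X Z.
Proof. by rewrite -!mul_ad mulmxDl. Qed.
Lemma br_scaler a X Y : br X (a *: Y) = a *: br X Y.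
Proof. by rewrite -!mul_ad -scalemxAl. Qed.
Lemma br_scalel a X Y : br (a *: X) Y = a *: br X Y.
Proof. by rewrite br_anti br_scaler -scalerN -br_anti. Qed.
Lemma br0r X : br X 0 = 0.
Proof. by rewrite -mul_ad mul0mx. Qed.
Lemma br_sumr I (r : seq I) (C : pred I) (F : I -> vec) X :
  br X (\sum_(i <- r | C i) F i) = \sum_(i <- r | C i) br X (F i).
Proof. by rewrite -mul_ad mulmx_suml; apply: eq_bigr => i _; rewrite mul_ad. Qed.

Lemma jacobi X Y Z : br X (br Y Z) = br (br X Y) Z + br Y (br X Z).
Proof.
case: lie_br => _ _ /(_ X Y Z) /eqP.
rewrite -addrA addr_eq0 => /eqP ->.
by rewrite opprD -(br_anti (br X Y)) (br_anti Z X) -!mul_ad mulNmx opprK addrC.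
Qed.

(** The commutator looks reversed because row vectors make [ad Y *m ad X] apply [ad Y] first. *)
Lemma ad_br X Y : ad (br X Y) = ad Y *m ad X - ad X *m ad Y.
Proof.
apply: eq_mx_mulrV => v; rewrite mulmxBr !mulmxA !mul_ad jacobi.
by rewrite addrK.
Qed.

Lemma ip_killing X Y : ip B X Y = killing br X Y.
Proof.
apply: ip_gram => a u v w; rewrite /killing linearP.
  by rewrite mulmxDl -scalemxAl linearP.
by rewrite mulmxDr -scalemxAr linearP.
Qed.

Lemma killing_sym X Y : killing br X Y = killing br Y X.
Proof. by rewrite /killing mxtrace_mulC. Qed.

Lemma killing_tr : B^T = B.
Proof. by apply/matrixP => a b; rewrite !mxE killing_sym. Qed.

Lemma ip_killing_sym X Y : ip B X Y = ip B Y X.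
Proof. by rewrite ip_tr killing_tr. Qed.

Lemma killing_inv X Y Z : ip B (br X Y) Z = ip B X (br Y Z).
Proof.
rewrite !ip_killing /killing !ad_br mulmxBl mulmxBr !linearB /= !mulmxA.
by congr (_ - _); rewrite -(mulmxA (ad Y)) mxtrace_mulC.
Qed.

(** Invariance of [B] in the matrix form that [tr_skew_selfadj] consumes. *)
Lemma ad_skew X : ad X *m B = - (B *m (ad X)^T).
Proof.
apply: eq_ip => u v.
rewrite -ip_mull [RHS]/ip mulmxN mulNmx [RHS]mxE -/(ip _ u v) -ip_mulr !mul_ad.
by rewrite br_anti ipNl killing_inv.
Qed.

(** * Levi-Civita connection and Ricci form of a metric [B(T -, -)] *)

Section Ricci.
Variable T : 'M[R]_N.
Hypotheses (B_unit : B \in unitmx) (T_unit : T \in unitmx).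
Hypothesis T_selfadj : T *m B = B *m T^T.

(* The endomorphism [v |-> nabla_v Y] of the metric [B(T -, -)]. *)
Definition conn Y : 'M[R]_N :=
  2^-1 *: (T *m ad Y *m invmx T - ad Y - ad (Y *m T) *m invmx T).

Lemma nablaE X Y : nabla br (T *m B) X Y = X *m conn Y.
Proof.
have eT u v : ip (T *m B) u v = ip (T *m B) v u.
  by rewrite ip_tr trmx_mul killing_tr -T_selfadj.
have adS Z u v : ip B (u *m ad Z) v = - ip B u (v *m ad Z).
  by rewrite !mul_ad br_anti ipNl killing_inv.
(* Invariance of [B] isolates the basis vector in each Koszul term, so the row is a vector times
   [B]; this [B] then cancels against the inverse of [T *m B]. *)
rewrite /nabla (_ : \row_c _ = 2^-1 *:
    ((X *m T *m ad Y + br X Y *m T + Y *m T *m ad X) *m B)); last first.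
  apply/rowP => c; rewrite [RHS]mxE -ip_ebasr !ipDl mxE.
  rewrite -(ip_mull _ T (br X Y)) ![ip (T *m B) (br _ _) _]eT.
  rewrite -(ip_mull _ T X) -(ip_mull _ T Y) -killing_inv (br_anti _ X) ipNr.
  rewrite -killing_inv !mul_ad (br_anti Y) (br_anti X (Y *m T)) !ipNl.
  by congr (_ * _); lra.
have VB : invmx (T *m B) = invmx B *m invmx T.
  have TBu : T *m B \in unitmx by rewrite unitmx_mul T_unit.
  apply: (can_inj (mulKmx TBu)); rewrite mulmxV //.
  by rewrite mulmxA (mulmxK B_unit) mulmxV.
rewrite VB -!scalemxAl mulmxA (mulmxK B_unit) -scalemxAr; congr (_ *: _).
rewrite !mulmxBr !mulmxDl !mulmxA !mul_ad (mulmxK T_unit).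
by rewrite (br_anti Y X) (br_anti (Y *m T)) mulNmx !opprK.
Qed.

(** The two terms containing [T] are together symmetric in [X] and [Y]; only the half bracket is
    skew. *)
Lemma nabla_torsion X Y :
  nabla br (T *m B) X Y - nabla br (T *m B) Y X = br X Y.
Proof.
rewrite !nablaE /conn -!scalemxAr -scalerBr.
rewrite !mulmxBr !mulmxA !mul_ad (br_anti (X *m T)) (br_anti Y X) mulNmx.
rewrite (br_anti (Y *m T)) mulNmx.
move: (br X (Y *m T) *m _) (br Y (X *m T) *m _) (br X Y) => a b c.
by apply/rowP => i; rewrite !mxE; lra.
Qed.

(** Conjugation by [T] preserves the trace of [ad Y], so the first two terms cancel. The third is a
    skew operator times the self-adjoint [invmx T]. *)
Lemma tr_conn Y : \tr (conn Y) = 0.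
Proof.
have tr_ad Z : \tr (ad Z) = 0.
  rewrite -[ad Z]mulmx1; apply: (tr_skew_selfadj B_unit (ad_skew Z)).
  by rewrite trmx1 mulmx1 mul1mx.
have TV : invmx T *m B = B *m (invmx T)^T.
  apply: (can_inj (mulKmx T_unit)); rewrite mulKVmx //.
  by rewrite mulmxA T_selfadj -mulmxA -trmx_mul mulVmx // trmx1 mulmx1.
rewrite /conn linearZ !linearB /= mxtrace_mulC mulmxA mulVmx // mul1mx subrr.
by rewrite (tr_skew_selfadj B_unit (ad_skew _) TV) subrr mulr0.
Qed.

(** [C] is the endomorphism sending [X] to the curvature applied to [X, Y, Z]. In its trace the
    first term vanishes by [tr_conn] and the two terms with [ad Y] cancel by cyclicity. *)
Lemma ricciE Y Z : ricci br (T *m B) Y Z = - \tr (conn Y *m conn Z).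
Proof.
pose C := conn (nabla br (T *m B) Y Z) - conn Z *m (conn Y + ad Y)
          + ad Y *m conn Z.
have eC X : curv br (T *m B) X Y Z = X *m C.
  (* Torsion-freeness makes the derivative in the fixed direction [Y] an explicit endomorphism of
     [V]. *)
  have eN V : nabla br (T *m B) Y V = V *m (conn Y + ad Y).
    by rewrite mulmxDr -nablaE mul_ad -nabla_torsion addrC subrK.
  rewrite /curv (nablaE X (nabla br _ Y Z)) (nablaE X Z).
  rewrite (nablaE (br X Y)) /C (mulmxDr X) (mulmxBr X) !mulmxA.
by rewrite mul_ad (br_anti Y) mulNmx (eN Z) (eN (X *m _)).
rewrite /ricci (eq_bigr (fun c => C c c)); last first.
  by move=> c _; rewrite eC -rowE mxE.
rewrite -/(\tr C) /C mxtraceD linearB /= tr_conn mulmxDr mxtraceD.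
by rewrite (mxtrace_mulC (ad Y)) sub0r opprD addrNK mxtrace_mulC.
Qed.
End Ricci.
End LieAlgebra.

(** * Real eigenvectors of a symmetric form relative to a positive definite one *)

Section Eigenvector.
Variables (R : realType) (n : nat) (S G : 'M[R]_n).
Hypotheses (n_gt0 : (0 < n)%N) (S_sym : S^T = S) (G_sym : G^T = G).
Hypothesis G_pos : forall v, v != 0 -> 0 < ip G v v.

Lemma posdef_unitmx : G \in unitmx.
Proof.
rewrite -row_free_unit; apply: inj_row_free => v vG0.
by apply/eqP/negP => /negP /G_pos; rewrite /ip vG0 mul0mx mxE ltxx.
Qed.

(** A complex eigenvector always exists. Symmetry forces its eigenvalue to be real, and then its
    real and imaginary parts satisfy the same equation, at least one of them being nonzero. *)
Lemma symmetric_pencil_eigenvector :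
  exists (c : R) (v : 'rV[R]_n), v != 0 /\ v *m S = c *: (v *m G).
Proof.
pose toC : R -> R[i] := real_complex R.
pose A := map_mx toC (S *m invmx G).
have [z] : exists z, root (char_poly A) z.
  by apply/closed_rootP; rewrite size_char_poly eqSS -lt0n.
rewrite -eigenvalue_root_char => /eigenvalueP [v vA v_n0].
have {vA} vS : v *m map_mx toC S = z *: (v *m map_mx toC G).
  rewrite scalemxAl -vA -mulmxA -map_mxM.
  by rewrite mulmxKV // posdef_unitmx.
pose u : 'rV[R]_n := map_mx (@complex.Re R) v.
pose w : 'rV[R]_n := map_mx (@complex.Im R) v.
have ReM (M : 'M[R]_n) j : complex.Re ((v *m map_mx toC M) 0 j) = (u *m M) 0 j.
  rewrite !mxE (big_morph (@complex.Re R) (id1 := 0) (op1 := +%R)) //;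
    last by case=> ? ? [].
  by apply: eq_bigr => i _; rewrite !mxE; case: (v 0 i) => a b /=; rewrite mulr0 subr0.
have ImM (M : 'M[R]_n) j : complex.Im ((v *m map_mx toC M) 0 j) = (w *m M) 0 j.
  rewrite !mxE (big_morph (@complex.Im R) (id1 := 0) (op1 := +%R)) //;
    last by case=> ? ? [].
  by apply: eq_bigr => i _; rewrite !mxE; case: (v 0 i) => a b /=; rewrite mulr0 add0r.
have comb a b (r s : 'rV[R]_n) j :
    (a *: r + b *: s) 0 j = a * r 0 j + b * s 0 j by rewrite !mxE.
have uS : u *m S = complex.Re z *: (u *m G) + - complex.Im z *: (w *m G).
  apply/rowP => j; have := congr1 (fun r : 'rV_n => complex.Re (r 0 j)) vS.
  rewrite /= ReM [X in complex.Re X]mxE => ->; rewrite comb -!ReM -!ImM.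
  by case: z {vS} => a b /=; case: (_ 0 j) => ? ? /=; rewrite mulNr.
have wS : w *m S = complex.Im z *: (u *m G) + complex.Re z *: (w *m G).
  apply/rowP => j; have := congr1 (fun r : 'rV_n => complex.Im (r 0 j)) vS.
  rewrite /= ImM [X in complex.Im X]mxE => ->; rewrite comb -!ReM -!ImM.
  by case: z {vS uS} => a b /=; case: (_ 0 j) => ? ? /=; rewrite addrC.
have ipE1 a b x x' (y : 'rV[R]_n) : (a *: (x *m G *m y^T) + b *: (x' *m G *m y^T)) 0 0
    = a * ip G x y + b * ip G x' y by rewrite /ip !mxE.
have ipGC x y : ip G x y = ip G y x by rewrite ip_tr G_sym.
have Gge0 x : 0 <= ip G x x.
  by case: (eqVneq x 0) => [->|/G_pos/ltW //]; rewrite ip0l.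
have vN0 : (u != 0) || (w != 0).
  rewrite -negb_and; apply: contra v_n0 => /andP[/eqP u0 /eqP w0].
  apply/eqP/rowP => j; rewrite mxE.
  have := congr1 (fun r : 'rV_n => r 0 j) u0.
  have := congr1 (fun r : 'rV_n => r 0 j) w0.
  by rewrite !mxE; case: (v 0 j) => a b /= -> ->.
have norm_gt0 : 0 < ip G u u + ip G w w.
  case/orP: vN0 => /G_pos h; first by rewrite ltr_wpDr.
  by rewrite ltr_wpDl.
(* [ip S u w = ip S w u] reads [complex.Im z * (ip G u u + ip G w w) = 0]. *)
have Imz : complex.Im z = 0.
  have : ip S u w = ip S w u by rewrite ip_tr S_sym.
  have ipS x : ip S x = fun y => (x *m S *m y^T) 0 0 by [].
  rewrite !ipS uS wS !mulmxDl -!scalemxAl !ipE1.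
  rewrite (ipGC w u) => h.
  have /eqP : complex.Im z * (ip G u u + ip G w w) = 0 by lra.
  by rewrite mulf_eq0 (gt_eqF norm_gt0) orbF => /eqP.
case/orP: vN0 => h; [exists (complex.Re z), u | exists (complex.Re z), w]; split=> //.
  by rewrite uS Imz oppr0 scale0r addr0.
by rewrite wS Imz scale0r add0r.
Qed.

End Eigenvector.

(** * Traces of Casimir operators as contractions of the bracket *)

Section CasimirSymmetry.
Variables (R : realType) (N : nat).
Local Notation vec := 'rV[R]_N.
Variable br : vec -> vec -> vec.
Hypothesis lie_br : lie_algebra br.
Local Notation B := (gram (killing br)).
Local Notation ad := (ad br).
Local Notation e := (@ebas R N).
Hypothesis B_unit : B \in unitmx.
Implicit Types (X Y Z : vec) (A P : 'M[R]_N).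

Let Bi := invmx B.

Lemma invmx_killing_sym a b : Bi a b = Bi b a.
Proof. by rewrite /Bi -{1}(killing_tr br) -trmx_inv mxE. Qed.

(** Contraction with the inverse of [B] does for this indefinite form what summing over an
    orthonormal basis does for a definite one. *)
Lemma mxtrace_killing A :
  \tr A = \sum_a \sum_b Bi a b * ip B (e a *m A) (e b).
Proof.
rewrite -[in LHS](mulmxK B_unit A) /mxtrace; apply: eq_bigr => a _.
rewrite [LHS]mxE; apply: eq_bigr => b _.
by rewrite ip_ebasr /ebas -mulmxA -rowE mulrC (invmx_killing_sym b)
  [RHS]mulrC [X in _ = X * _]mxE mulrC.
Qed.

(** When [P] is a [B]-self-adjoint projection, the sum runs over dual bases of its image: it is the
    trace of the Casimir element of that image, with [P2] inserted between the two factors and [P1]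
    in front. *)
Definition casimir_trace P P1 P2 :=
  \sum_a \sum_b Bi a b * \tr (P1 *m ad (e a *m P) *m P2 *m ad (e b *m P)).

(** Expanding the inner trace and moving one [ad] across [B] gives a full contraction of two
    brackets, in which [P] and [P2] play parallel roles. The minus sign comes from the skewness of
    [ad]. *)
Lemma casimir_traceE P P1 P2 :
  P2 *m P2 = P2 -> P2 *m B = B *m P2^T ->
  casimir_trace P P1 P2 =
    - \sum_a \sum_b \sum_c \sum_d Bi a b * Bi c d *
      ip B (br (e b *m P) (e c *m P2) *m P1) (br (e a *m P) (e d *m P2)).
Proof.
move=> P2P2 P2B; rewrite /casimir_trace -sumrN; apply: eq_bigr => a _.
rewrite -sumrN; apply: eq_bigr => b _.
rewrite -{1}P2P2 (mulmxA _ P2) -mulmxA mxtrace_mulC !mulmxA mxtrace_killing.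
rewrite mulr_sumr -sumrN; apply: eq_bigr => c _.
rewrite mulr_sumr -sumrN; apply: eq_bigr => d _.
rewrite mulrA -mulrN; congr (_ * _).
rewrite !mulmxA ip_mull P2B -ip_mulr !(mul_ad lie_br).
by rewrite [X in ip B X _ = _](br_anti lie_br) ipNl (killing_inv lie_br).
Qed.

Let sum4_rev (F : 'I_N -> 'I_N -> 'I_N -> 'I_N -> R) :
  \sum_a \sum_b \sum_c \sum_d F a b c d = \sum_a \sum_b \sum_c \sum_d F d c b a.
Proof.
rewrite [RHS]exchange_big; under eq_bigr do rewrite exchange_big.
rewrite exchange_big; under eq_bigr do under eq_bigr do rewrite exchange_big.
by under eq_bigr do rewrite exchange_big; rewrite exchange_big.
Qed.

(** Reversing the four indices exchanges [P] and [P2]: each of the two brackets changes sign, and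
    [Bi] is symmetric. *)
Lemma casimir_trace_swap P P1 P2 :
  P *m P = P -> P *m B = B *m P^T -> P2 *m P2 = P2 -> P2 *m B = B *m P2^T ->
  casimir_trace P P1 P2 = casimir_trace P2 P1 P.
Proof.
move=> PP PB P2P2 P2B; rewrite !casimir_traceE //; congr (- _).
rewrite sum4_rev; apply: eq_bigr => a _; apply: eq_bigr => b _.
apply: eq_bigr => c _; apply: eq_bigr => d _.
rewrite (br_anti lie_br (e c *m P)) (br_anti lie_br (e d *m P)).
by rewrite mulNmx ipNl ipNr opprK (mulrC (Bi a b))
  (invmx_killing_sym d) (invmx_killing_sym b).
Qed.

End CasimirSymmetry.

(** * Orthogonal complements and traces over subspaces *)

Lemma sub_orthmx (R : realType) (N m : nat) (M : 'M[R]_N) (U : 'M_(m, N))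
    (v : 'rV_N) :
  reflect (forall u : 'rV_N, (u <= U)%MS -> ip M v u = 0)
          (v <= kermx (M *m U^T))%MS.
Proof.
apply: (iffP sub_kermxP) => [vU u /submxP [d ->]|vU].
  by rewrite /ip trmx_mul mulmxA -(mulmxA v) vU mul0mx mxE.
apply/rowP => i; have := vU _ (row_sub i U).
by rewrite /ip rowE trmx_mul !mulmxA trmx_delta -colE !mxE.
Qed.

(** [P *m A] factors through [row_base U]; cyclicity brings that basis to the front, where [P] fixes
    it. Traces over subspaces thus become traces of full matrices, free of a choice of basis. *)
Lemma tr_onE (R : realType) (n : nat) (U P A : 'M[R]_n) :
  (forall u : 'rV_n, (u <= U)%MS -> u *m P = u) ->
  (forall u : 'rV_n, (u *m P *m A <= U)%MS) ->
  tr_on U A = \tr (P *m A).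
Proof.
move=> UP PAU; rewrite /tr_on -[P *m A](@mulmxKpV _ _ _ _ _ (row_base U)).
  rewrite [RHS]mxtrace_mulC !mulmxA (_ : row_base U *m P = row_base U) //.
  apply/row_matrixP => i; rewrite row_mul UP //.
  by rewrite -(eq_row_base U) row_sub.
apply/row_subP => i; rewrite eq_row_base rowE mulmxA; exact: PAU.
Qed.

Lemma tr_eq0_swap (R : comRingType) n (A P P' : 'M[R]_n) :
  P + P' = 1%:M -> P *m A *m P = 0 -> P' *m A *m P' = 0 ->
  P *m P = P -> P' *m P' = P' -> \tr A = 0.
Proof.
move=> PP' PA P'A PP P'P'; rewrite -[A]mul1mx -PP' mulmxDl mxtraceD.
rewrite -PP -P'P' -!(mulmxA _ _ A) mxtrace_mulC PA mxtrace_mulC P'A.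
by rewrite !mxtrace0 addr0.
Qed.

Lemma ip_congr (R : realType) (n N : nat) (b : 'M[R]_(n, N)) M u v :
  ip (b *m M *m b^T) u v = ip M (u *m b) (v *m b).
Proof. by rewrite /ip trmx_mul !mulmxA. Qed.

(** * Cartan decompositions: projections and nondegeneracy of the Killing form *)

Section Cartan.
Variables (R : realType) (N : nat).
Local Notation vec := 'rV[R]_N.
Variable br : vec -> vec -> vec.
Variables k p : 'M[R]_N.
Hypothesis lie_br : lie_algebra br.
Hypothesis cartan : cartan_decomp br k p.
Local Notation B := (gram (killing br)).
Local Notation ad := (ad br).
Implicit Types (X Y Z K v w : vec).

Let brkk X Y : (X <= k)%MS -> (Y <= k)%MS -> (br X Y <= k)%MS.
Proof. by case: cartan => _ h _ _ _; apply: h. Qed.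
Let brkp X Y : (X <= k)%MS -> (Y <= p)%MS -> (br X Y <= p)%MS.
Proof. by case: cartan => _ _ h _ _; apply: h. Qed.
Let brpk X Y : (X <= p)%MS -> (Y <= k)%MS -> (br X Y <= p)%MS.
Proof. by move=> Xp Yk; rewrite (br_anti lie_br) -scaleN1r scalemx_sub ?brkp. Qed.
Let brpp X Y : (X <= p)%MS -> (Y <= p)%MS -> (br X Y <= k)%MS.
Proof. by case: cartan => _ _ _ h _; apply: h. Qed.
Let k_neg X : (X <= k)%MS -> X != 0 -> ip B X X < 0.
Proof. by rewrite (ip_killing lie_br); case: cartan => _ _ _ _ [h _]; apply: h. Qed.
Let p_pos X : (X <= p)%MS -> X != 0 -> 0 < ip B X X.
Proof. by rewrite (ip_killing lie_br); case: cartan => _ _ _ _ [_ h]; apply: h. Qed.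

Lemma cartan_disjoint : (k :&: p = 0)%MS.
Proof. by case: cartan => [[/mxdirect_addsP]]. Qed.
Lemma cartan_disjointC : (p :&: k = 0)%MS.
Proof. by rewrite capmxC cartan_disjoint. Qed.

Local Notation Pk := (proj_mx k p).
Local Notation Pp := (proj_mx p k).

Lemma cartan_split v : v *m Pk + v *m Pp = v.
Proof.
apply: add_proj_mx; first exact: cartan_disjoint.
apply: submx_full; rewrite /row_full.
by case: cartan => [[_ ->]].
Qed.

Lemma cartan_proj1 : Pk + Pp = 1%:M.
Proof. by apply: eq_mx_mulrV => v; rewrite mulmxDr mulmx1 cartan_split. Qed.

Lemma projk_id v : (v <= k)%MS -> v *m Pk = v.
Proof. exact: proj_mx_id cartan_disjoint. Qed.
Lemma projk_0 v : (v <= p)%MS -> v *m Pk = 0.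
Proof. exact: proj_mx_0 cartan_disjoint. Qed.
Lemma projp_id v : (v <= p)%MS -> v *m Pp = v.
Proof. exact: proj_mx_id cartan_disjointC. Qed.
Lemma projp_0 v : (v <= k)%MS -> v *m Pp = 0.
Proof. exact: proj_mx_0 cartan_disjointC. Qed.
Lemma projk_sub v : (v *m Pk <= k)%MS.
Proof. exact: proj_mx_sub. Qed.
Lemma projp_sub v : (v *m Pp <= p)%MS.
Proof. exact: proj_mx_sub. Qed.

Lemma projk_idem : Pk *m Pk = Pk.
Proof. by apply: eq_mx_mulrV => v; rewrite mulmxA projk_id ?projk_sub. Qed.
Lemma projp_idem : Pp *m Pp = Pp.
Proof. by apply: eq_mx_mulrV => v; rewrite mulmxA projp_id ?projp_sub. Qed.

Lemma tr_cartan_swap A :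
  (forall v, (v <= k)%MS -> (v *m A <= p)%MS) ->
  (forall v, (v <= p)%MS -> (v *m A <= k)%MS) -> \tr A = 0.
Proof.
move=> Akp Apk; apply: (tr_eq0_swap cartan_proj1) projk_idem projp_idem.
  by apply: eq_mx_mulrV => v; rewrite mulmx0 2!(mulmxA v) projk_0 ?Akp ?projk_sub.
by apply: eq_mx_mulrV => v; rewrite mulmx0 2!(mulmxA v) projp_0 ?Apk ?projp_sub.
Qed.

(** [ad X] preserves [k] and [p] while [ad Y] exchanges them, so their product has zero diagonal
    blocks. *)
Lemma killing_kp X Y : (X <= k)%MS -> (Y <= p)%MS -> ip B X Y = 0.
Proof.
move=> Xk Yp; rewrite (ip_killing lie_br); apply: tr_cartan_swap => v hv.
  by rewrite mulmxA !(mul_ad lie_br) brpk ?brkk.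
by rewrite mulmxA !(mul_ad lie_br) brpp ?brkp.
Qed.

(** [k] and [p] are orthogonal and [B] is definite on each, so its radical is zero. *)
Lemma killing_unitmx : B \in unitmx.
Proof.
rewrite -row_free_unit; apply: inj_row_free => v vB0.
have B0 w : ip B v w = 0 by rewrite /ip vB0 mul0mx mxE.
have vk0 : v *m Pk = 0.
  apply/eqP/negP => /negP /(k_neg (projk_sub v)).
  rewrite -{1}[v *m Pk](addrK (v *m Pp)) cartan_split ipDl B0 ipNl.
  by rewrite ip_killing_sym killing_kp ?projk_sub ?projp_sub // subr0 ltxx.
have vp0 : v *m Pp = 0.
  apply/eqP/negP => /negP /(p_pos (projp_sub v)).
  have -> : v *m Pp = v by rewrite -{2}(cartan_split v) vk0 add0r.
  by rewrite B0 ltxx.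
by rewrite -(cartan_split v) vk0 vp0 addr0.
Qed.

(** * Irreducibility of the isotropy representation and Schur's lemma *)

Section Irreducible.
Hypothesis simple_br : simple_lie br.

(* [W + h] is an ideal, where [h] is the annihilator in [k] of the orthogonal
   complement of [W] in [p]. *)
Lemma isotropy_irreducible (W : 'M[R]_N) :
  (W <= p)%MS -> (forall K Y, (K <= k)%MS -> (Y <= W)%MS -> (br K Y <= W)%MS) ->
  W != 0 -> (p <= W)%MS.
Proof.
move=> Wp Wk W0.
pose O := kermx (B *m W^T); pose W' := (p :&: O)%MS.
pose h := (k :&: \bigcap_a kermx (ad (row a W')))%MS.
have hP X : reflect ((X <= k)%MS /\ forall Y, (Y <= W')%MS -> br X Y = 0)
                    (X <= h)%MS.
  apply: (iffP idP) => [|[Xk XW']].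
    rewrite sub_capmx => /andP[Xk /sub_bigcapmxP Xa]; split=> // Y /submxP [d ->].
    rewrite mulmx_sum_row (br_sumr lie_br) big1 // => a _.
    rewrite -(mul_ad lie_br) -scalemxAl (mul_ad lie_br) (br_anti lie_br).
    rewrite -(mul_ad lie_br).
    by move/sub_kermxP: (Xa a isT) => ->; rewrite oppr0 scaler0.
  rewrite sub_capmx Xk; apply/sub_bigcapmxP => a _; apply/sub_kermxP.
  by rewrite (mul_ad lie_br) (br_anti lie_br) XW' ?row_sub ?oppr0.
have W'p Y : (Y <= W')%MS -> (Y <= p)%MS by rewrite sub_capmx => /andP[].
have W'O Y w : (Y <= W')%MS -> (w <= W)%MS -> ip B Y w = 0.
  by rewrite sub_capmx => /andP[_ /sub_orthmx]; apply.
have Wp' Y : (Y <= W)%MS -> (Y <= p)%MS by move/submx_trans; apply.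
have W'k K Y : (K <= k)%MS -> (Y <= W')%MS -> (br K Y <= W')%MS.
  move=> Kk YW'; rewrite sub_capmx brkp ?W'p //=.
  apply/sub_orthmx => w wW; rewrite (br_anti lie_br) ipNl.
  by rewrite (killing_inv lie_br) W'O ?Wk ?oppr0.
(* [B([w,w'], [w,w']) = B(w, [w', [w,w']])] vanishes because [k] preserves [W'], while [B] is
   negative definite on [k]. *)
have WW' w w' : (w <= W)%MS -> (w' <= W')%MS -> br w w' = 0.
  move=> wW w'W'; apply/eqP/negP => /negP.
  have zk : (br w w' <= k)%MS by apply: brpp; [exact: Wp' | exact: W'p].
  move/(k_neg zk); rewrite (killing_inv lie_br) (br_anti lie_br w') ipNr.
  by rewrite ip_killing_sym W'O ?oppr0 ?ltxx // W'k.
have splitp Y : (Y <= p)%MS ->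
    exists w w', [/\ (w <= W)%MS, (w' <= W')%MS & Y = w + w'].
  move=> Yp.
  have WO0 : (W :&: O = 0)%MS.
    apply/eqP; rewrite -submx0; apply/row_subP => i.
    have := row_sub i (W :&: O)%MS; rewrite sub_capmx => /andP[rW /sub_orthmx /(_ _ rW)].
    have [->|r0] := eqVneq (row i (W :&: O)%MS) 0; first by rewrite sub0mx.
    by move/eqP; rewrite gt_eqF // p_pos // Wp'.
  (* Dimension count: since [B] is nondegenerate, the codimension of [O] is the rank of [W]. *)
  have full : row_full (W + O)%MS.
    rewrite /row_full (mxrank_disjoint_sum WO0) mxrank_ker.
    rewrite -(mxrank_tr (B *m W^T)) trmx_mul trmxK killing_tr.
    by rewrite mxrankMfree ?row_free_unit ?killing_unitmx //
      subnKC ?rank_leq_row ?rank_leq_col.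
  have /sub_addsmxP [[u u'] /= Yuu'] := submx_full Y full.
  exists (u *m W), (u' *m O); rewrite submxMl; split=> //.
  rewrite sub_capmx submxMl andbT.
  by rewrite -[u' *m O](addKr (u *m W)) -Yuu' addmx_sub //
    -scaleN1r scalemx_sub ?Wp' ?submxMl.
have ideal_Wh : ideal_in br 1%:M (W + h)%MS.
  split=> [|X Y /sub_addsmxP [[u x] /= ->] _]; first exact: submx1.
  have wW : (u *m W <= W)%MS by rewrite submxMl.
  have /hP [xk xW'] : (x *m h <= h)%MS by rewrite submxMl.
  move: (u *m W) (x *m h) wW xk xW' => {u x} w x wW xk xW'.
  rewrite -(cartan_split Y); move: (projk_sub Y) (projp_sub Y).
  move: (Y *m Pk) (Y *m Pp) => yk yp ykk /splitp [w1 [w2 [w1W w2W' ->]]].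
  rewrite !(br_addl lie_br) !(br_addr lie_br).
  rewrite (WW' w w2) // (xW' w2) // !addr0.
  have inW v : (v <= W)%MS -> (v <= W + h)%MS.
    by move/submx_trans; apply; apply: addsmxSl.
  have inh v : (v <= h)%MS -> (v <= W + h)%MS.
    by move/submx_trans; apply; apply: addsmxSr.
  (* Four brackets remain: [[w, yk]] and [[x, w1]] lie in [W], whereas [[w, w1]] and [[x, yk]] lie
     in [h] by the Jacobi identity. *)
  apply: addmx_sub; apply: addmx_sub.
  - by apply: inW; rewrite (br_anti lie_br) -scaleN1r scalemx_sub ?Wk.
  - apply: inh; apply/hP; split=> [|w' w'W']; first by rewrite brpp ?Wp'.
    have := jacobi lie_br w w1 w'.
    by rewrite (WW' w w') // (WW' w1 w') // !(br0r lie_br) addr0.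
  - apply: inh; apply/hP; split=> [|w' w'W']; first by rewrite brkk.
    have := jacobi lie_br x yk w'.
    by rewrite (xW' w') // (xW' (br yk w')) ?W'k // (br0r lie_br) addr0.
  - by apply: inW; apply: Wk.
case: simple_br => _ /(_ _ ideal_Wh) [/eqP|Wh1].
  rewrite mxrank_eq0 => /eqP Wh0; case/negP: W0; rewrite -submx0 -Wh0.
  exact: addsmxSl.
(* If [W + h] is the whole algebra, the [h]-component of a vector of [p] lies in both [k] and [p],
   hence is zero. *)
apply/row_subP => i; have : (row i p <= W + h)%MS by rewrite Wh1 submx1.
case/sub_addsmxP => [[u x] /= e].
have /hP [xk _] : (x *m h <= h)%MS by rewrite submxMl.
have xp : (x *m h <= p)%MS.
  rewrite -[x *m h](addKr (u *m W)) -e addmx_sub ?row_sub //.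
  by rewrite -scaleN1r scalemx_sub ?Wp' ?submxMl.
have : (x *m h <= k :&: p)%MS by rewrite sub_capmx xk.
by rewrite cartan_disjoint submx0 e => /eqP ->; rewrite addr0 submxMl.
Qed.

(** On [p], [F] has a real eigenvector relative to [B]. By invariance its eigenspace [W] is a
    [k]-submodule, so irreducibility makes it all of [p]. *)
Lemma isotropy_schur (F : 'M[R]_N) :
  (0 < \rank p)%N ->
  (forall X Y, (X <= p)%MS -> (Y <= p)%MS -> ip F X Y = ip F Y X) ->
  (forall K X Y, (K <= k)%MS -> (X <= p)%MS -> (Y <= p)%MS ->
     ip F (br K X) Y + ip F X (br K Y) = 0) ->
  exists c, forall X Y, (X <= p)%MS -> (Y <= p)%MS -> ip F X Y = c * ip B X Y.
Proof.
move=> p_gt0 F_sym F_inv.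
(* Forms are pulled back to coordinates on [p], where [B] is positive definite as the eigenvector
   lemma requires. *)
pose b := row_base p; pose pull (M : 'M[R]_N) := b *m M *m b^T.
have bp (v : 'rV_(\rank p)) : (v *m b <= p)%MS by rewrite -(eq_row_base p) submxMl.
have ip_pull M (u v : 'rV_(\rank p)) : ip (pull M) u v = ip M (u *m b) (v *m b).
  exact: ip_congr.
have sym_pull M : (forall X Y, (X <= p)%MS -> (Y <= p)%MS -> ip M X Y = ip M Y X) ->
    (pull M)^T = pull M.
  by move=> Ms; apply: eq_ip => u v; rewrite -ip_tr !ip_pull Ms.
have pos (v : 'rV_(\rank p)) : v != 0 -> 0 < ip (pull B) v v.
  move=> v0; rewrite ip_pull p_pos //; apply: contra v0 => /eqP vb0.
  by apply/eqP; apply: (row_free_inj (row_base_free p)); rewrite mul0mx.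
have [c [v [v0 vF]]] := symmetric_pencil_eigenvector p_gt0 (sym_pull _ F_sym)
  (sym_pull _ (fun X Y _ _ => ip_killing_sym br X Y)) pos.
have ipB M X Y : ip (M - c *: B) X Y = ip M X Y - c * ip B X Y.
  by rewrite /ip mulmxBr mulmxBl -scalemxAr -scalemxAl [LHS]mxE
    ![(- _ : 'M_1) _ _]mxE ![(_ *: _ : 'M_1) _ _]mxE.
pose W := (p :&: kermx ((F - c *: B) *m p^T))%MS.
have WP X : reflect ((X <= p)%MS /\ forall Y, (Y <= p)%MS -> ip F X Y = c * ip B X Y)
                    (X <= W)%MS.
  apply: (iffP idP) => [|[Xp XE]].
    rewrite sub_capmx => /andP[Xp /sub_orthmx XE]; split=> // Y /XE.
    by rewrite ipB => /eqP; rewrite subr_eq0 => /eqP.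
  by rewrite sub_capmx Xp; apply/sub_orthmx => Y Yp; rewrite ipB XE ?subrr.
have pW : (p <= W)%MS.
  apply: isotropy_irreducible => [|K Y Kk /WP [Yp YE]|]; first exact: capmxSl.
    apply/WP; split=> [|Z Zp]; first exact: brkp.
    have := F_inv K Y Z Kk Yp Zp; rewrite YE ?brkp // => h.
    have : ip B (br K Y) Z = - ip B Y (br K Z).
      by rewrite (br_anti lie_br) ipNl (killing_inv lie_br).
    by move=> ->; lra.
  have vW : (v *m b <= W)%MS.
    apply/WP; split=> // Y; rewrite -(eq_row_base p) => /submxP [u ->].
    rewrite -!ip_pull; have ipS M : ip M v = fun y => (v *m M *m y^T) 0 0 by [].
    by rewrite !ipS vF -scalemxAl mxE.
  apply/eqP => W0; move: vW; rewrite W0 submx0 => /eqP vb0.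
  by move: (pos v v0); rewrite ip_pull vb0 ip0l ltxx.
by exists c => X Y /submx_trans /(_ pW) /WP [_]; apply.
Qed.

End Irreducible.
End Cartan.

(** * The inner product [Q] and its orthogonal projections *)

Section QProjections.
Variables (R : realType) (N : nat).
Local Notation vec := 'rV[R]_N.
Variable br : vec -> vec -> vec.
Variables k p : 'M[R]_N.
Hypothesis lie_br : lie_algebra br.
Hypothesis cartan : cartan_decomp br k p.
Local Notation B := (gram (killing br)).
Local Notation ad := (ad br).
Local Notation Pk := (proj_mx k p).
Local Notation Pp := (proj_mx p k).
Local Notation Qf := (Qform br k p).
Local Notation Qproj U := (proj_mx U (Qperp br k p U)).
Implicit Types (X Y Z K v w : vec) (U : 'M[R]_N).

Lemma QformE X Y : Qf X Y = ip B (X *m Pp) (Y *m Pp) - ip B (X *m Pk) (Y *m Pk).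
Proof. by rewrite /Qform !(ip_killing lie_br). Qed.

Lemma Qform_k X Y : (X <= k)%MS -> Qf X Y = - ip B X Y.
Proof.
move=> Xk; rewrite QformE (projp_0 cartan Xk) ip0l sub0r (projk_id cartan Xk).
rewrite -[in RHS](cartan_split cartan Y) ipDr.
by rewrite [X in _ + X](killing_kp lie_br cartan) ?projp_sub // addr0.
Qed.

Lemma Qform_p X Y : (X <= p)%MS -> Qf X Y = ip B X Y.
Proof.
move=> Xp; rewrite QformE (projk_0 cartan Xp) ip0l subr0 (projp_id cartan Xp).
rewrite -[in RHS](cartan_split cartan Y) ipDr (ip_killing_sym br X (Y *m Pk)).
by rewrite [X in X + _](killing_kp lie_br cartan) ?projk_sub // add0r.
Qed.

Lemma ip_Qform X Y : ip (gram Qf) X Y = Qf X Y.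
Proof.
by apply: ip_gram => a u v w; rewrite !QformE !mulmxDl -!scalemxAl
  ?(ipDl, ipZl, ipDr, ipZr); ring.
Qed.

Lemma Qform_gt0 X : X != 0 -> 0 < Qf X X.
Proof.
move=> X0; rewrite QformE.
case: cartan => _ _ _ _ [kneg ppos].
have hp : 0 <= ip B (X *m Pp) (X *m Pp).
  have [->|h] := eqVneq (X *m Pp) 0; first by rewrite ip0l.
  by rewrite (ip_killing lie_br) ltW // ppos ?projp_sub.
have hk : ip B (X *m Pk) (X *m Pk) <= 0.
  have [->|h] := eqVneq (X *m Pk) 0; first by rewrite ip0l.
  by rewrite (ip_killing lie_br) ltW // kneg ?projk_sub.
have [p0|h] := eqVneq (X *m Pp) 0; last first.
  have : 0 < ip B (X *m Pp) (X *m Pp).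
    by rewrite (ip_killing lie_br) ppos ?projp_sub.
  by lra.
have h : X *m Pk != 0.
  by apply: contra X0 => /eqP k0; rewrite -(cartan_split cartan X) p0 k0 addr0.
have : ip B (X *m Pk) (X *m Pk) < 0.
  by rewrite (ip_killing lie_br) kneg ?projk_sub.
by lra.
Qed.

Lemma sub_Qperp U X :
  reflect (forall Y, (Y <= U)%MS -> Qf X Y = 0) (X <= Qperp br k p U)%MS.
Proof.
apply: (iffP (sub_orthmx _ _ _)) => h Y YU.
  by rewrite -ip_Qform h // eq_row_base.
by rewrite ip_Qform h // -(eq_row_base U).
Qed.

(** Definiteness of [Q] gives this, and it is what lets [proj_mx] onto [U] along [Qperp] act as a
    projection. *)
Lemma Qperp_disjoint U : (U :&: Qperp br k p U = 0)%MS.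
Proof.
apply/eqP; rewrite -submx0; apply/row_subP => i.
have := row_sub i (U :&: Qperp br k p U)%MS.
rewrite sub_capmx => /andP[rU /sub_Qperp /(_ _ rU)].
have [->|r0] := eqVneq (row i (U :&: Qperp br k p U)%MS) 0; first by rewrite sub0mx.
by move/eqP; rewrite gt_eqF // Qform_gt0.
Qed.

Lemma Qproj_id U X : (X <= U)%MS -> X *m Qproj U = X.
Proof. exact: proj_mx_id (Qperp_disjoint U). Qed.

Lemma Qproj_0 U X : (forall Y, (Y <= U)%MS -> Qf X Y = 0) -> X *m Qproj U = 0.
Proof. by move/sub_Qperp; apply: proj_mx_0 (Qperp_disjoint U). Qed.

Lemma Qproj_p : Qproj p = Pp.
Proof.
apply: eq_mx_mulrV => v; rewrite -(cartan_split cartan v) 2!mulmxDl.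
rewrite [X in X + _]Qproj_0 => [|Y Yp]; last first.
  by rewrite Qform_k ?projk_sub // (killing_kp lie_br cartan) ?projk_sub ?oppr0.
rewrite Qproj_id ?projp_sub // (projp_0 cartan (projk_sub _ _ v)).
by rewrite (projp_id cartan (projp_sub _ _ v)).
Qed.

End QProjections.

(** * The ideals of [k]: brackets and orthogonality *)

Section NaturallyReductive.
Variables (R : realType) (N : nat).
Local Notation vec := 'rV[R]_N.
Variable br : vec -> vec -> vec.
Variables (k p D Zk : 'M[R]_N) (m : nat) (ks : 'I_m -> 'M[R]_N).
Variable kappa : 'I_m -> R.
Hypothesis lie_br : lie_algebra br.
Hypothesis simple_br : simple_lie br.
Hypothesis cartan : cartan_decomp br k p.
Hypothesis rank_p : (0 < \rank p)%N.
Hypothesis center_Zk : is_center br k Zk.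
Hypothesis sum_ks : (\sum_(i < m) ks i :=: k)%MS.
Hypothesis direct_ks : mxdirect (\sum_(i < m) ks i).
Hypothesis rank_ks : forall i, (0 < \rank (ks i))%N.
Hypothesis ks_simple_or_center : forall i,
  (ideal_in br D (ks i) /\ simple_subalg br (ks i)) \/ (ks i :=: Zk)%MS.
Hypothesis killing_ks : forall i X Y, (X <= ks i)%MS -> (Y <= ks i)%MS ->
  killing_on br (ks i) X Y = kappa i * killing br X Y.
Local Notation B := (gram (killing br)).
Local Notation ad := (ad br).
Local Notation Pk := (proj_mx k p).
Local Notation Pp := (proj_mx p k).
Implicit Types (X Y Z K v w : vec) (i j l : 'I_m).

Let ad_lin := ad_is_linear lie_br.
Let mulad := mul_ad lie_br.
Let B_unit : B \in unitmx := killing_unitmx lie_br cartan.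

Lemma ks_k i : (ks i <= k)%MS.
Proof. by rewrite -sum_ks (sumsmx_sup i). Qed.

Lemma sub_ks_k i X : (X <= ks i)%MS -> (X <= k)%MS.
Proof. by move/submx_trans; apply; apply: ks_k. Qed.

Lemma ks_decomp X : (X <= k)%MS ->
  exists x : 'I_m -> vec, (forall i, (x i <= ks i)%MS) /\ X = \sum_i x i.
Proof.
rewrite -sum_ks => /sub_sumsmxP [u ->].
by exists (fun i => u i *m ks i); split=> // i; apply: submxMl.
Qed.

Lemma ks_disjoint i j X : i != j -> (X <= ks i)%MS -> (X <= ks j)%MS -> X = 0.
Proof.
move=> ij Xi Xj; apply/eqP; rewrite -submx0.
move/mxdirect_sumsP: direct_ks => /(_ i isT) <-.
by rewrite sub_capmx Xi (submx_trans Xj) // (sumsmx_sup j) // eq_sym.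
Qed.

(** A simple factor is only assumed to be an ideal of [D]. Each factor of [k] lies in [D] or is
    central, and central brackets vanish. *)
Lemma ks_ideal i X Y : (X <= ks i)%MS -> (Y <= k)%MS -> (br X Y <= ks i)%MS.
Proof.
move=> Xi /ks_decomp [y [yl ->]]; rewrite (br_sumr lie_br).
apply: summx_sub => l _; case: (ks_simple_or_center i) => [[[_ idl] _]|iZ].
  case: (ks_simple_or_center l) => [[[lD _] _]|lZ].
    by apply: idl => //; apply: submx_trans (yl l) lD.
  have := yl l; rewrite lZ => /center_Zk [_ /(_ X (sub_ks_k Xi)) yX].
  by rewrite (br_anti lie_br) yX oppr0 sub0mx.
move: Xi; rewrite iZ => /center_Zk [_ ->]; first exact: sub0mx.
exact: sub_ks_k (yl l).
Qed.

Lemma ks_ideal_r i X Y : (X <= k)%MS -> (Y <= ks i)%MS -> (br X Y <= ks i)%MS.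
Proof.
by move=> Xk Yi; rewrite (br_anti lie_br) -scaleN1r scalemx_sub ?ks_ideal.
Qed.

Lemma ks_commute i j X Y :
  i != j -> (X <= ks i)%MS -> (Y <= ks j)%MS -> br X Y = 0.
Proof.
move=> ij Xi Yj; apply: (ks_disjoint ij).
  by rewrite ks_ideal // (sub_ks_k Yj).
by rewrite ks_ideal_r // (sub_ks_k Xi).
Qed.

(** The part of [ks j] orthogonal to [ks i] contains all brackets of [ks j], because the two factors
    commute and [B] is invariant. It is therefore a nonzero ideal, and simplicity makes it all of
    [ks j]. *)
Lemma killing_ks_simple i j X Y : i != j -> simple_subalg br (ks j) ->
  (X <= ks i)%MS -> (Y <= ks j)%MS -> ip B Y X = 0.
Proof.
move=> ij [[U [V [Uj Vj UV0]]] simple_j] Xi Yj.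
pose W := (ks j :&: kermx (B *m (ks i)^T))%MS.
have brW U1 V1 : (U1 <= ks j)%MS -> (V1 <= ks j)%MS -> (br U1 V1 <= W)%MS.
  move=> Uj1 Vj1; rewrite sub_capmx ks_ideal ?(sub_ks_k Vj1) //=.
  apply/sub_orthmx => x xi.
  by rewrite (killing_inv lie_br) (ks_commute _ Vj1 xi) ?ip0r // eq_sym.
have ideal_W : ideal_in br (ks j) W.
  split=> [|U1 V1]; first exact: capmxSl.
  by rewrite sub_capmx => /andP[U1j _]; apply: brW.
case: (simple_j _ ideal_W) => [/eqP|Wj].
  rewrite mxrank_eq0 => /eqP W0; have := brW _ _ Uj Vj.
  by rewrite W0 submx0 (negPf UV0).
by move: Yj; rewrite -Wj sub_capmx => /andP[_ /sub_orthmx]; apply.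
Qed.

Lemma killing_ks_orth i j X Y :
  i != j -> (X <= ks i)%MS -> (Y <= ks j)%MS -> ip B X Y = 0.
Proof.
move=> ij Xi Yj.
case: (ks_simple_or_center i) => [[_ si]|iZ].
  by apply: (killing_ks_simple _ si Yj Xi); rewrite eq_sym.
case: (ks_simple_or_center j) => [[_ sj]|jZ].
  by rewrite ip_killing_sym (killing_ks_simple ij sj).
(* Two distinct central factors would both equal [Zk], against directness and nonzero rank. *)
have : (ks i <= ks i :&: \sum_(l < m | l != i) ks l)%MS.
  by rewrite sub_capmx submx_refl iZ -jZ (sumsmx_sup j) // eq_sym.
move/mxdirect_sumsP: direct_ks => /(_ i isT) ->.
by rewrite submx0 -mxrank_eq0 -leqn0 leqNgt rank_ks.
Qed.

(** Taken along the [Q]-orthogonal complement so as to be the very projection inside [Qrestr]. *)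
Definition ks_proj i := proj_mx (ks i) (Qperp br k p (ks i)).
Local Notation P := ks_proj.

Lemma ks_proj_sub i v : (v *m P i <= ks i)%MS.
Proof. exact: proj_mx_sub. Qed.

Lemma ks_proj_id i X : (X <= ks i)%MS -> X *m P i = X.
Proof. exact: (Qproj_id lie_br cartan). Qed.

Lemma ks_proj_0 i j X : j != i -> (X <= ks j)%MS -> X *m P i = 0.
Proof.
move=> ji Xj; apply: (Qproj_0 lie_br cartan) => Y Yi.
rewrite (Qform_k lie_br cartan) ?(sub_ks_k Xj) //.
by rewrite (killing_ks_orth ji) ?oppr0.
Qed.

Lemma ks_proj_p i X : (X <= p)%MS -> X *m P i = 0.
Proof.
move=> Xp; apply: (Qproj_0 lie_br cartan) => Y Yi.
rewrite (Qform_p lie_br cartan) // ip_killing_sym.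
by rewrite (killing_kp lie_br cartan) ?(sub_ks_k Yi).
Qed.

(** * Operators that are scalar on [p] and on each [ks i] *)

Lemma eq_mx_blocks (M M' : 'M[R]_N) :
  (forall v, (v <= p)%MS -> v *m M = v *m M') ->
  (forall i v, (v <= ks i)%MS -> v *m M = v *m M') -> M = M'.
Proof.
move=> ep ek; apply: eq_mx_mulrV => v; rewrite -(cartan_split cartan v) 2!mulmxDl.
rewrite [in RHS]addrC -[in RHS]ep ?projp_sub // addrC; congr (_ + _).
have /ks_decomp [x [xi ->]] := projk_sub k p v.
by rewrite !mulmx_suml; apply: eq_bigr => i _; apply: ek (xi i).
Qed.

(** Acts by [b] on [p] and by [a i] on [ks i]. The operator [T], its inverse and the projections all
    have this form, so products, adjoints and commutation with [ad K] are settled once. *)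
Definition blockmx (b : R) (a : 'I_m -> R) : 'M[R]_N :=
  b *: Pp + \sum_i a i *: P i.

Lemma blockmx_p b a v : (v <= p)%MS -> v *m blockmx b a = b *: v.
Proof.
move=> vp; rewrite mulmxDr -scalemxAr (projp_id cartan vp) mulmx_sumr big1 ?addr0 //.
by move=> i _; rewrite -scalemxAr ks_proj_p // scaler0.
Qed.

Lemma blockmx_ks b a i v : (v <= ks i)%MS -> v *m blockmx b a = a i *: v.
Proof.
move=> vi; rewrite mulmxDr -scalemxAr (projp_0 cartan (sub_ks_k vi)) scaler0 add0r.
rewrite mulmx_sumr (bigD1 i) //= big1 ?addr0 => [|j ji]; last first.
  by rewrite -scalemxAr (@ks_proj_0 j i) ?scaler0 // eq_sym.
by rewrite -scalemxAr ks_proj_id.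
Qed.

Lemma blockmx_k b a v : (v <= k)%MS -> (v *m blockmx b a <= k)%MS.
Proof.
move=> /ks_decomp [x [xi ->]]; rewrite mulmx_suml; apply: summx_sub => i _.
by rewrite (blockmx_ks _ _ (xi i)) scalemx_sub // (sub_ks_k (xi i)).
Qed.

Lemma blockmx_mul b a b' a' :
  blockmx b a *m blockmx b' a' = blockmx (b * b') (fun i => a i * a' i).
Proof.
apply: eq_mx_blocks => [v vp|i v vi]; rewrite mulmxA.
  by rewrite !blockmx_p ?scalemx_sub // scalerA mulrC.
by rewrite !(@blockmx_ks _ _ i) ?scalemx_sub // scalerA mulrC.
Qed.

Lemma blockmx1 : blockmx 1 (fun=> 1) = 1%:M.
Proof.
apply: eq_mx_blocks => [v vp|i v vi]; rewrite mulmx1.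
  by rewrite blockmx_p // scale1r.
by rewrite (blockmx_ks _ _ vi) scale1r.
Qed.

Lemma projkE : Pk = \sum_i P i.
Proof.
have := cartan_proj1 cartan; rewrite -blockmx1 /blockmx scale1r addrC => /addrI ->.
by apply: eq_bigr => i _; rewrite scale1r.
Qed.

(** Orthogonality of the blocks gives [B(u P, v) = B(u P, v P)], which is symmetric in [u] and
    [v]. *)
Lemma ks_proj_adjoint i : P i *m B = B *m (P i)^T.
Proof.
have PP u v : ip B (u *m P i) v = ip B (u *m P i) (v *m P i).
  rewrite -[in LHS](cartan_split cartan v) ipDr.
  rewrite [X in _ + X](killing_kp lie_br cartan) ?projp_sub //; last first.
    exact: sub_ks_k (ks_proj_sub i u).
  rewrite addr0 projkE mulmx_sumr ip_sumr (bigD1 i) //= big1 ?addr0 // => l li.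
  by apply: (@killing_ks_orth i l); rewrite ?ks_proj_sub // eq_sym.
apply: eq_ip => u v; rewrite -(ip_mull B) -(ip_mulr B) PP [RHS]ip_killing_sym [RHS]PP.
exact: ip_killing_sym.
Qed.

Lemma projp_adjoint : Pp *m B = B *m Pp^T.
Proof.
have PP u v : ip B (u *m Pp) v = ip B (u *m Pp) (v *m Pp).
  rewrite -[in LHS](cartan_split cartan v) ipDr.
  rewrite (ip_killing_sym br _ (v *m Pk)).
  by rewrite [X in X + _](killing_kp lie_br cartan) ?projp_sub ?projk_sub // add0r.
apply: eq_ip => u v; rewrite -(ip_mull B) -(ip_mulr B) PP [RHS]ip_killing_sym [RHS]PP.
exact: ip_killing_sym.
Qed.

Lemma blockmx_adjoint b a : blockmx b a *m B = B *m (blockmx b a)^T.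
Proof.
rewrite /blockmx linearD linearZ linear_sum /= mulmxDl mulmxDr -scalemxAl -scalemxAr.
rewrite projp_adjoint mulmx_suml mulmx_sumr; congr (_ + _).
by apply: eq_bigr => i _; rewrite linearZ -scalemxAl -scalemxAr /= ks_proj_adjoint.
Qed.

Lemma ks_proj_idem i : P i *m P i = P i.
Proof. by apply: eq_mx_mulrV => v; rewrite mulmxA ks_proj_id ?ks_proj_sub. Qed.

Lemma mxtrace_adjoint (M M' : 'M[R]_N) : M *m B = B *m M'^T -> \tr M = \tr M'.
Proof.
move=> MB; rewrite -(mulmxK B_unit M) MB mxtrace_mulC mulmxA mulVmx // mul1mx.
exact: mxtrace_tr.
Qed.

Lemma ad_k_p K : (K <= k)%MS -> forall v, (v <= p)%MS -> (v *m ad K <= p)%MS.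
Proof. by move=> Kk v vp; rewrite mulad; case: cartan => _ _ h _ _; apply: h. Qed.

Lemma ad_p_p X : (X <= p)%MS -> forall v, (v <= p)%MS -> (v *m ad X <= k)%MS.
Proof. by move=> Xp v vp; rewrite mulad; case: cartan => _ _ _ h _; apply: h. Qed.

Lemma ad_p_k X : (X <= p)%MS -> forall v, (v <= k)%MS -> (v *m ad X <= p)%MS.
Proof.
move=> Xp v vk; rewrite mulad (br_anti lie_br) -scaleN1r scalemx_sub // -mulad.
exact: ad_k_p.
Qed.

Lemma ad_k_k K : (K <= k)%MS -> forall v, (v <= k)%MS -> (v *m ad K <= k)%MS.
Proof. by move=> Kk v vk; rewrite mulad; case: cartan => _ h _ _ _; apply: h. Qed.

(** [ad K] preserves [p] and every ideal [ks i], on each of which the block operator is a scalar. *)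
Lemma ad_k_block K b a : (K <= k)%MS -> ad K *m blockmx b a = blockmx b a *m ad K.
Proof.
move=> Kk; apply: eq_mx_blocks => [v vp|i v vi]; rewrite !mulmxA.
  by rewrite !blockmx_p ?ad_k_p // -scalemxAl.
by rewrite !(@blockmx_ks _ _ i) -?scalemxAl // mulad ks_ideal_r.
Qed.

Lemma ks_proj_block i : P i = blockmx 0 (fun l => (l == i)%:R).
Proof.
rewrite /blockmx scale0r add0r (bigD1 i) //= eqxx scale1r big1 ?addr0 //.
by move=> l /negPf ->; rewrite scale0r.
Qed.

Lemma projp_block : Pp = blockmx 1 (fun=> 0).
Proof.
by rewrite /blockmx scale1r big1 ?addr0 // => i _; rewrite scale0r.
Qed.

(** * Traces over [p] and [k], and the Casimir forms on [p] *)

Lemma mxtrace_proj (U Q : 'M[R]_N) :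
  (forall v, (v <= U)%MS -> v *m Q = v) -> (forall v, (v *m Q <= U)%MS) ->
  \tr Q = (\rank U)%:R.
Proof.
move=> QU Qs; have := @tr_onE _ _ U Q 1%:M QU.
rewrite mulmx1 => <- => [|u]; last by rewrite mulmx1.
by rewrite /tr_on mulmx1 mulmxVp ?row_base_free // mxtrace1.
Qed.

(** The other factors commute with [ks i], so the trace over [k] is the Killing form of [ks i]. *)
Lemma tr_projk_ad_ad i K K' : (K <= ks i)%MS -> (K' <= ks i)%MS ->
  \tr (Pk *m ad K *m ad K') = kappa i * ip B K K'.
Proof.
move=> Ki K'i; rewrite (ip_killing lie_br) -killing_ks //.
rewrite /killing_on (@tr_onE _ _ (ks i) (P i)); first last.
- move=> v; rewrite (mulmxA _ (ad K)) !mulad.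
  exact: ks_ideal_r (sub_ks_k K'i) (ks_ideal_r (sub_ks_k Ki) (ks_proj_sub i v)).
- by move=> u; apply: ks_proj_id.
rewrite [in RHS]mulmxA; congr (\tr (_ *m _)).
apply: eq_mx_blocks => [v vp|l v vl]; rewrite (mulmxA v Pk) (mulmxA v (P i)).
  by rewrite (projk_0 cartan) // ks_proj_p.
rewrite (projk_id cartan (sub_ks_k vl)).
have [li|li] := eqVneq l i; first by rewrite ks_proj_id -?li.
by rewrite (ks_proj_0 li vl) mulad (ks_commute _ Ki vl) ?mul0mx // eq_sym.
Qed.

(** The traces over [k] and [p] add up to [B]. *)
Lemma tr_projp_ad_ad i K K' : (K <= ks i)%MS -> (K' <= ks i)%MS ->
  \tr (Pp *m ad K *m ad K') = (1 - kappa i) * ip B K K'.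
Proof.
move=> Ki K'i; rewrite mulrBl -(tr_projk_ad_ad Ki K'i) mul1r (ip_killing lie_br).
rewrite /killing; apply/eqP; rewrite eq_sym subr_eq -mxtraceD -2!mulmxDl.
by rewrite addrC (cartan_proj1 cartan) mul1mx.
Qed.

(* The compression to [p] of the Casimir operator of [ks i], as a form. *)
Definition casimir_form i X Y := \tr (Pp *m ad X *m P i *m ad Y).

Lemma ip_casimir_form i X Y : ip (gram (casimir_form i)) X Y = casimir_form i X Y.
Proof.
apply: ip_gram => c u v w; rewrite /casimir_form ad_lin.
  by rewrite mulmxDr !mulmxDl -scalemxAr -!scalemxAl linearP.
by rewrite mulmxDr -scalemxAr linearP.
Qed.

Lemma adjoint_mul (M1 M1' M2 M2' : 'M[R]_N) :
  M1 *m B = B *m M1'^T -> M2 *m B = B *m M2'^T ->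
  M1 *m M2 *m B = B *m (M2' *m M1')^T.
Proof. by move=> e1 e2; rewrite -mulmxA e2 mulmxA e1 -mulmxA -trmx_mul. Qed.

(** The [B]-adjoint reverses the product and negates both [ad] factors; the trace is unchanged. *)
Lemma casimir_form_sym i X Y : casimir_form i X Y = casimir_form i Y X.
Proof.
have adA Z : ad Z *m B = B *m (- ad Z)^T.
  by rewrite (ad_skew lie_br) linearN mulmxN.
rewrite /casimir_form (@mxtrace_adjoint _ (- ad Y *m (P i *m (- ad X *m Pp)))).
  rewrite mulNmx (mulNmx (ad X)) !mulmxN opprK.
  move: Pp (P i) (ad X) (ad Y) => A1 A2 A3 A4.
  by rewrite !mulmxA [LHS]mxtrace_mulC !mulmxA.
apply: adjoint_mul (adA Y); apply: adjoint_mul (ks_proj_adjoint i).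
exact: adjoint_mul projp_adjoint (adA X).
Qed.

(** [ad K] commutes with both projections, so the sum is the trace of a commutator with [ad K]. *)
Lemma casimir_form_inv i K X Y : (K <= k)%MS ->
  casimir_form i (br K X) Y + casimir_form i X (br K Y) = 0.
Proof.
move=> Kk; rewrite /casimir_form !(ad_br lie_br).
have PK : ad K *m P i = P i *m ad K by rewrite ks_proj_block ad_k_block.
have PpK : ad K *m Pp = Pp *m ad K by rewrite projp_block ad_k_block.
move: Pp (P i) (ad K) (ad X) (ad Y) PK PpK => Q S AK AX AY SK QK.
rewrite !(mulmxBl, mulmxBr) !linearB /= !mulmxA.
rewrite -(mulmxA _ AK S) SK -QK -!(mulmxA AK) (mxtrace_mulC AK) !mulmxA.
by lra.
Qed.

(* The constant is found by taking the trace over [p]; exchanging the roles of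
   [p] and [ks i] turns it into a trace over [ks i]. *)
Lemma casimir_formE i X Y : (X <= p)%MS -> (Y <= p)%MS ->
  casimir_form i X Y = (\rank (ks i))%:R * (1 - kappa i) / (\rank p)%:R * ip B X Y.
Proof.
move=> Xp Yp.
have [c cE] : exists c, forall X Y, (X <= p)%MS -> (Y <= p)%MS ->
    casimir_form i X Y = c * ip B X Y.
  have [||c cE] := isotropy_schur lie_br cartan simple_br
    (F := gram (casimir_form i)) rank_p.
  - by move=> X1 Y1 _ _; rewrite !ip_casimir_form casimir_form_sym.
  - by move=> K X1 Y1 Kk _ _; rewrite !ip_casimir_form casimir_form_inv.
  by exists c => X1 Y1 X1p Y1p; rewrite -cE // ip_casimir_form.
rewrite cE //; congr (_ * _).
have rank_p0 : (\rank p)%:R != 0 :> R by rewrite pnatr_eq0 -lt0n.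
apply: (mulIf rank_p0); rewrite mulfVK //.
have := casimir_trace_swap lie_br B_unit Pp (projp_idem cartan) projp_adjoint
  (ks_proj_idem i) (ks_proj_adjoint i).
rewrite /casimir_trace.
(* This side becomes [c] times the trace of [Pp], that is [c] times the rank of [p]. *)
under eq_bigr => a _ do under eq_bigr => b _ do
  rewrite -/(casimir_form i _ _) cE ?projp_sub // mulrCA (ip_mulr B)
    -projp_adjoint -ip_mull -mulmxA (projp_idem cartan).
under eq_bigr => a _ do rewrite -mulr_sumr.
rewrite -mulr_sumr -(mxtrace_killing B_unit) (@mxtrace_proj p); first last.
- exact: projp_sub.
- exact: (projp_id cartan).
move=> ->.
(* On the other side [ad K] commutes with [Pp], so the second projection is absorbed and the sum is
   [1 - kappa i] times the trace of [P i]. *)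
have trE K K' : (K <= ks i)%MS -> (K' <= ks i)%MS ->
    \tr (Pp *m ad K *m Pp *m ad K') = (1 - kappa i) * ip B K K'.
  move=> Ki K'i; rewrite -(tr_projp_ad_ad Ki K'i); congr (\tr (_ *m _)).
  have PpK : ad K *m Pp = Pp *m ad K.
    by rewrite projp_block ad_k_block // (sub_ks_k Ki).
  by rewrite -mulmxA PpK mulmxA (projp_idem cartan).
under eq_bigr => a _ do under eq_bigr => b _ do
  rewrite trE ?ks_proj_sub // mulrCA (ip_mulr B)
    -ks_proj_adjoint -ip_mull -mulmxA ks_proj_idem.
under eq_bigr => a _ do rewrite -mulr_sumr.
rewrite -mulr_sumr -(mxtrace_killing B_unit) (@mxtrace_proj (ks i)).
- by rewrite mulrC.
- exact: ks_proj_id.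
exact: ks_proj_sub.
Qed.

(** * Connection and Ricci curvature of the naturally reductive metric *)

Section Metric.
Variables (beta : R) (alpha : 'I_m -> R).
Hypotheses (beta_gt0 : 0 < beta) (alpha_gt0 : forall i, 0 < alpha i).
Local Notation g := (gram (fun X Y => beta * Qrestr br k p p X Y
                   + \sum_(i < m) alpha i * Qrestr br k p (ks i) X Y)).

(* Signs come from [Q = B] on [p] and [Q = - B] on [k]: [g = B(T -, -)]. *)
Definition metric_op := blockmx beta (fun i => - alpha i).
Local Notation T := metric_op.

Let beta0 : beta != 0. Proof. by rewrite gt_eqF. Qed.
Let alpha0 i : alpha i != 0. Proof. by rewrite gt_eqF. Qed.

Lemma Qrestr_p X Y : Qrestr br k p p X Y = ip B (X *m Pp) Y.
Proof.
rewrite /Qrestr (Qproj_p lie_br cartan) (Qform_p lie_br cartan) ?projp_sub //.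
by rewrite (ip_mulr B) -projp_adjoint -(ip_mull B) -mulmxA (projp_idem cartan).
Qed.

Lemma Qrestr_ks i X Y : Qrestr br k p (ks i) X Y = - ip B (X *m P i) Y.
Proof.
rewrite /Qrestr -/(P i) (Qform_k lie_br cartan) ?(sub_ks_k (ks_proj_sub _ _)) //.
by rewrite (ip_mulr B) -ks_proj_adjoint -(ip_mull B) -mulmxA ks_proj_idem.
Qed.

Lemma metricE : g = T *m B.
Proof.
apply/matrixP => a b; rewrite mxE -[in RHS]ip_ebas -(ip_mull B) Qrestr_p.
rewrite mulmxDr -scalemxAr ipDl ipZl; congr (_ + _).
rewrite mulmx_sumr ip_suml; apply: eq_bigr => i _.
by rewrite Qrestr_ks -scalemxAr ipZl mulrN mulNr.
Qed.

Lemma metric_op_inv :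
  T \in unitmx /\ invmx T = blockmx beta^-1 (fun i => - (alpha i)^-1).
Proof.
have TV : T *m blockmx beta^-1 (fun i => - (alpha i)^-1) = 1%:M.
  rewrite blockmx_mul mulfV // -blockmx1 /blockmx; congr (_ + _).
  by apply: eq_bigr => i _; rewrite mulrNN mulfV.
have [Tu _] := mulmx1_unit TV; split=> //.
by rewrite -[RHS](mulKmx Tu) TV mulmx1.
Qed.

Lemma ricci_metric X Y :
  ricci br g X Y = - \tr (conn br T X *m conn br T Y).
Proof.
rewrite metricE; apply: (ricciE lie_br B_unit); first by case: metric_op_inv.
exact: blockmx_adjoint.
Qed.

(** On [p] the two terms with [T] cancel, leaving half of [- ad Y]. On [ks i] the bracket falls in
    [p], where [T] is [beta], and the three terms sum to [- (alpha i / beta + 2)] before halving. *)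
Lemma conn_p Y : (Y <= p)%MS ->
  conn br T Y = blockmx (- 2^-1) (fun i => - (alpha i / (2 * beta) + 1)) *m ad Y.
Proof.
move=> Yp; rewrite /conn; case: metric_op_inv => _ ->; rewrite (blockmx_p _ _ Yp).
apply: eq_mx_blocks => [v vp|i v vi]; rewrite -scalemxAr !mulmxBr !(mulmxA v).
  rewrite !(blockmx_p _ _ vp) -!scalemxAl !mulad (br_scalel lie_br) -scalemxAl.
  by rewrite addrAC subrr sub0r scalerN scaleNr.
rewrite !(blockmx_ks _ _ vi) -!scalemxAl !mulad (br_scalel lie_br) -scalemxAl.
have wp : (br Y v <= p)%MS by rewrite -mulad ad_p_k // (sub_ks_k vi).
rewrite (blockmx_p _ _ wp); move: (br Y v) => w.
by apply/rowP => c; rewrite !mxE; field.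
Qed.

Lemma conn_ks j Y : (Y <= ks j)%MS ->
  conn br T Y = blockmx (alpha j / (2 * beta)) (fun=> - 2^-1) *m ad Y.
Proof.
move=> Yj; rewrite /conn; case: metric_op_inv => _ ->; rewrite (blockmx_ks _ _ Yj).
have Yk := sub_ks_k Yj.
apply: eq_mx_blocks => [v vp|i v vi]; rewrite -scalemxAr !mulmxBr !(mulmxA v).
  rewrite !(blockmx_p _ _ vp) -!scalemxAl !mulad (br_scalel lie_br) -scalemxAl.
  have wp : (br Y v <= p)%MS by rewrite -mulad ad_k_p.
  rewrite (blockmx_p _ _ wp); move: (br Y v) => w.
  by apply/rowP => c; rewrite !mxE; field.
rewrite !(blockmx_ks _ _ vi) -!scalemxAl !mulad (br_scalel lie_br) -scalemxAl.
(* Distinct factors commute, so both sides vanish there and one constant serves all of [k]. *)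
have [ij|ij] := eqVneq i j; last first.
  by rewrite (ks_commute _ Yj vi) ?mul0mx ?scaler0 ?subrr ?scaler0 // eq_sym.
have wi : (br Y v <= ks j)%MS by rewrite -ij ks_ideal_r.
rewrite (blockmx_ks _ _ wi) ij; move: (br Y v) => w.
by apply/rowP => c; rewrite !mxE; field.
Qed.

(** [ad X] exchanges [k] and [p], so only the two mixed terms of the trace survive. Each is half the
    same weighted sum of Casimir forms, by symmetry of these forms. *)
Lemma ricci_p X Y : (X <= p)%MS -> (Y <= p)%MS ->
  ricci br g X Y
  = - (\sum_(i < m) (alpha i / (2 * beta) + 1)
         * ((\rank (ks i))%:R * (1 - kappa i) / (\rank p)%:R))
    * Qrestr br k p p X Y.
Proof.
move=> Xp Yp; rewrite ricci_metric !conn_p // Qrestr_p (projp_id cartan Xp).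
rewrite mulNr; congr (- _); rewrite mulr_suml.
(* The part of the connection coefficients supported on [k], with sign reversed. *)
pose S := blockmx 0 (fun i => alpha i / (2 * beta) + 1).
have -> : blockmx (- 2^-1) (fun i => - (alpha i / (2 * beta) + 1)) = - (2^-1 *: Pp + S).
  rewrite /S /blockmx scale0r add0r scaleNr opprD -sumrN; congr (_ + _).
  by apply: eq_bigr => i _; rewrite scaleNr.
have PpPp Z : (Z <= p)%MS -> Pp *m ad Z *m Pp = 0.
  move=> Zp; apply: eq_mx_mulrV => v; rewrite mulmx0 2!(mulmxA v).
  by rewrite (projp_0 cartan) ?ad_p_p ?projp_sub.
have SS Z : (Z <= p)%MS -> S *m ad Z *m S = 0.
  move=> Zp; apply: eq_mx_blocks => [v vp|i v vi]; rewrite mulmx0 2!(mulmxA v).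
    by rewrite (blockmx_p _ _ vp) scale0r !mul0mx.
  by rewrite (blockmx_ks _ _ vi) blockmx_p ?scale0r // ad_p_k // scalemx_sub ?(sub_ks_k vi).
have trS U V : \tr (Pp *m ad U *m S *m ad V) =
    \sum_i (alpha i / (2 * beta) + 1) * casimir_form i U V.
  rewrite /S /blockmx scale0r add0r mulmx_sumr mulmx_suml linear_sum.
  by apply: eq_bigr => i _; rewrite -scalemxAr -scalemxAl linearZ.
have -> : \tr (- (2^-1 *: Pp + S) *m ad X *m (- (2^-1 *: Pp + S) *m ad Y))
   = 2^-1 * (\tr (Pp *m ad X *m S *m ad Y) + \tr (Pp *m ad Y *m S *m ad X)).
  move: (PpPp X Xp) (SS X Xp) => {PpPp SS trS}.
  move: Pp S (ad X) (ad Y) => Q S1 A1 A2 QQ S1S1.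
  rewrite !mulNmx mulmxN opprK !mulmxA !mulmxDl !mulmxDr !mulmxDl
    -!scalemxAl -!scalemxAr -!scalemxAl.
  rewrite QQ S1S1 mul0mx !scaler0 add0r addr0 mxtraceD !linearZ /=.
  by rewrite -(mulmxA (S1 *m A1)) (mxtrace_mulC (S1 *m A1)) !mulmxA mulrDr.
have rank_p0 : (\rank p)%:R != 0 :> R by rewrite pnatr_eq0 -lt0n.
rewrite !trS -big_split mulr_sumr; apply: eq_bigr => i _ /=.
rewrite !casimir_formE // (ip_killing_sym br Y); field.
by rewrite rank_p0 beta0.
Qed.

(** [ad X] commutes with block scalars, so the coefficients of the two connections multiply; [4^-1]
    is the square of [- 2^-1] on [k]. *)
Lemma ricci_k j l X Y : (X <= ks j)%MS -> (Y <= ks l)%MS ->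
  ricci br g X Y =
  - (alpha j / (2 * beta) * (alpha l / (2 * beta)) * \tr (Pp *m ad X *m ad Y)
     + 4^-1 * \tr (Pk *m ad X *m ad Y)).
Proof.
move=> Xj Yl; rewrite ricci_metric (conn_ks Xj) (conn_ks Yl); congr (- _).
rewrite mulmxA -(mulmxA (blockmx _ _)) ad_k_block ?(sub_ks_k Xj) //.
rewrite mulmxA blockmx_mul /blockmx projkE !mulmxDl mxtraceD -!scalemxAl linearZ /=.
congr (_ + _); rewrite !mulmx_suml !linear_sum mulr_sumr; apply: eq_bigr => i _.
by rewrite -!scalemxAl linearZ /=; congr (_ * _); field.
Qed.

(** The leading minus sign is absorbed because [Q] is [- B] on [k]. *)
Lemma ricci_ks j X Y : (X <= ks j)%MS -> (Y <= ks j)%MS ->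
  ricci br g X Y
  = 4^-1 * (alpha j ^+ 2 / beta ^+ 2 * (1 - kappa j) + kappa j)
    * Qrestr br k p (ks j) X Y.
Proof.
move=> Xj Yj; rewrite (ricci_k Xj Yj) (tr_projp_ad_ad Xj Yj) (tr_projk_ad_ad Xj Yj).
by rewrite Qrestr_ks ks_proj_id //; field.
Qed.

(** [conn br T X] exchanges [k] and [p] while [conn br T Y] preserves them, so their product has
    trace zero. *)
Lemma ricci_p_ks j X Y : (X <= p)%MS -> (Y <= ks j)%MS -> ricci br g X Y = 0.
Proof.
move=> Xp Yj; rewrite ricci_metric (conn_p Xp) (conn_ks Yj).
have Yk := sub_ks_k Yj.
rewrite (tr_cartan_swap cartan) ?oppr0 // => v hv; rewrite !mulmxA.
  have wp := ad_p_k Xp (blockmx_k (- 2^-1) (fun i => - (alpha i / (2 * beta) + 1)) hv).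
  by rewrite (blockmx_p _ _ wp); apply: ad_k_p; rewrite ?scalemx_sub.
rewrite (blockmx_p _ _ hv); apply: ad_k_k => //; apply: blockmx_k.
by apply: ad_p_p => //; apply: scalemx_sub.
Qed.

(** On [k] the product [ad X *m ad Y] is zero because distinct factors commute. The trace over [p]
    is then all of [B(X, Y)], which vanishes by orthogonality. *)
Lemma ricci_ks_ks j l X Y : j != l -> (X <= ks j)%MS -> (Y <= ks l)%MS ->
  ricci br g X Y = 0.
Proof.
move=> jl Xj Yl; rewrite (ricci_k Xj Yl).
have trk : Pk *m ad X *m ad Y = 0.
  apply: eq_mx_mulrV => v; rewrite mulmx0 2!(mulmxA v) !mulad.
  by rewrite (ks_commute _ Yl (ks_ideal Xj (projk_sub _ _ v))) // eq_sym.
have trp : \tr (Pp *m ad X *m ad Y) = 0.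
  rewrite -[Pp *m _ *m _]add0r -{1}trk -2!mulmxDl (cartan_proj1 cartan) mul1mx.
  by rewrite -/(killing br X Y) -(ip_killing lie_br) (killing_ks_orth jl).
by rewrite trk trp mxtrace0 !mulr0 addr0 oppr0.
Qed.
End Metric.

End NaturallyReductive.
Theorem theorem3p6 (R : realType) (N : nat)
    (br : 'rV[R]_N -> 'rV[R]_N -> 'rV[R]_N)
    (k p D Zk : 'M[R]_N) (m : nat) (ks : 'I_m -> 'M[R]_N)
    (kappa alpha : 'I_m -> R) (beta : R) :
  lie_algebra br -> simple_lie br ->
  cartan_decomp br k p -> (0 < \rank p)%N ->
  is_derived br k D -> is_center br k Zk ->
  (\sum_(i < m) ks i :=: k)%MS -> mxdirect (\sum_(i < m) ks i) ->
  (forall i, 0 < \rank (ks i))%N ->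
  (forall i, (ideal_in br D (ks i) /\ simple_subalg br (ks i))
             \/ (ks i :=: Zk)%MS) ->
  (forall i X Y, (X <= ks i)%MS -> (Y <= ks i)%MS ->
     killing_on br (ks i) X Y = kappa i * killing br X Y) ->
  0 < beta -> (forall i, 0 < alpha i) ->
  let g := gram (fun X Y => beta * Qrestr br k p p X Y
                   + \sum_(i < m) alpha i * Qrestr br k p (ks i) X Y) in
  let n := (\rank p)%:R in
  [/\ forall X Y, (X <= p)%MS -> (Y <= p)%MS ->
        ricci br g X Y
        = - (\sum_(i < m) (alpha i / (2 * beta) + 1)
               * ((\rank (ks i))%:R * (1 - kappa i) / n))
          * Qrestr br k p p X Y,
      forall j X Y, (X <= ks j)%MS -> (Y <= ks j)%MS ->
        ricci br g X Y
        = 4^-1 * (alpha j ^+ 2 / beta ^+ 2 * (1 - kappa j) + kappa j)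
          * Qrestr br k p (ks j) X Y,
      forall j X Y, (X <= p)%MS -> (Y <= ks j)%MS -> ricci br g X Y = 0 &
      forall j l X Y, j != l -> (X <= ks j)%MS -> (Y <= ks l)%MS ->
        ricci br g X Y = 0].
Proof.
move=> lie_br simple_br cartan rank_p derived_D center_Zk sum_ks direct_ks rank_ks.
move=> ks_or killing_ks beta_gt0 alpha_gt0 g n.
split=> [X Y Xp Yp|j X Y Xj Yj|j X Y Xp Yj|j l X Y jl Xj Yl].
- by eapply ricci_p; eassumption.
- by eapply ricci_ks; eassumption.
- by eapply ricci_p_ks; eassumption.
- by eapply ricci_ks_ks; eassumption.
Qed.
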